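(* Let $d\ge 2$ and $n,k\ge 0$ be integers. Then $N_d(n,k)$ equals the number of labelled Schröder paths in $\widetilde{\mathcal{S}}_d$ with semilength $n$ and with exactly $k$ occurrences in total of $H$ and $DD$.
   Context: $N_d(n,k) = \frac{1}{n+1} \binom{n+1}{k+1} \binom{ n + (n-k)(d-2)+1}{k}$. A Schröder path is a lattice path from $(0,0)$ using up steps $U=(1,1)$, down steps $D=(1,-1)$ and horizontal steps $H=(2,0)$, never going below the $x$-axis and ending on the $x$-axis at $(2m,0)$; $m$ is its semilength (the empty path, with $m=0$, is allowed). A descent is a maximal run of consecutive down steps. $\widetilde{\mathcal{S}}_d$ is the set of pairs consisting of a Schröder path in which every descent has length at most $d-1$, together with a labelling assigning to each descent of length $\ell\ge 1$ an $(\ell-1)$-element subset of $[d-2]=\{1,\dots,d-2\}$. The number of occurrences of $H$ and $DD$ is the number of $H$ steps plus the number of positions where a $D$ step is immediately followed by a $D$ step (so a descent of length $\ell$ contributes $\ell-1$). *)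

(* Defs.v *)
From HB Require Import structures.
From mathcomp Require Import all_boot all_order all_algebra.
From mathcomp Require Import boolp classical_sets functions cardinality.

Set Implicit Arguments.
Unset Strict Implicit.
Unset Printing Implicit Defensive.

Import Order.TTheory GRing.Theory Num.Theory.

Local Open Scope classical_set_scope.
Local Open Scope ring_scope.

(* The natural-number subtraction [n - k] truncates only when [n < k], and then
   the factor ['C(n.+1, k.+1)] is [0]. *)
Definition N_ (d n k : nat) : rat :=
  (n.+1%:R)^-1 * 'C(n.+1, k.+1)%:R * 'C(n + (n - k) * (d - 2) + 1, k)%:R.

Variant step := U | D | H.

Definition option_of_step (s : step) : option bool :=
  match s with U => Some true | D => Some false | H => None end.
Definition step_of_option (o : option bool) : step :=
  match o with Some true => U | Some false => D | None => H end.
Lemma option_of_stepK : cancel option_of_step step_of_option.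
Proof. by case. Qed.
HB.instance Definition _ := Finite.copy step (can_type option_of_stepK).

Definition dx (s : step) : nat := match s with U | D => 1 | H => 2 end.
Definition dy (s : step) : int := match s with U => 1 | D => -1 | H => 0 end.

Definition abscissa (p : seq step) : nat := (\sum_(s <- p) dx s)%N.
Definition ordinate (p : seq step) : int := \sum_(s <- p) dy s.

Definition schroder_path (p : seq step) : Prop :=
  (forall i : nat, (i <= size p)%N -> 0 <= ordinate (take i p)) /\
  ordinate p = 0.

(* The abscissa and the ordinate of the endpoint have the same parity, so
   halving is exact on a Schroder path. *)
Definition semilength (p : seq step) : nat := (abscissa p)./2.

(* Lengths of the maximal runs of [D], from left to right, in [p] preceded by
   [r] down steps. *)
Fixpoint descents_from (r : nat) (p : seq step) : seq nat :=
  match p with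
  | [::] => if r is 0 then [::] else [:: r]
  | D :: q => descents_from r.+1 q
  | _ :: q => if r is 0 then descents_from 0 q else r :: descents_from 0 q
  end.

Definition descents (p : seq step) : seq nat := descents_from 0 p.

(* The second component lists the labels of the descents from left to right;
   ['I_(d - 2)] stands for [d-2] = {1, ..., d-2}. *)
Definition labelled_path (d : nat) : Type :=
  (seq step * seq {set 'I_(d - 2)})%type.

Definition labelled_schroder (d : nat) : set (labelled_path d) :=
  [set x | [/\ schroder_path x.1,
              (forall l : nat, l \in descents x.1 -> (l <= d - 1)%N)
            & [seq #|A : {set 'I_(d - 2)}| | A <- x.2] =
              [seq (l - 1)%N | l <- descents x.1]]].

Arguments labelled_schroder : clear implicits.

Definition count_H (p : seq step) : nat := count_mem H p.
Definition count_DD (p : seq step) : nat :=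
  count_mem (D, D) (zip p (behead p)).

(* Main.v *)
(* Cut a labelled path before each [U] and each [H]. The pieces are letters of a
   finite alphabet, the semilength is the number of letters, and the path is
   determined by its word; it is a Schroder path iff the heights at the cuts are
   nonnegative and the last one is [0]. Prefixing the bare letter [U] turns these
   words into the words of [n + 1] letters with total rise [1] all of whose
   nonempty prefixes have positive rise. By the cycle lemma every word of total
   rise [1] has exactly one such rotation, which gives the factor [1 / (n + 1)].
   A word of total rise [1] with [k] occurrences of [H] and [DD] is one with
   [n - k] nonempty runs, so the unrestricted words are counted by the
   coefficient of [x^(n-k) y^k] in [((1 + y) (1 + x (1 + y)^(d-2)))^(n+1)]. *)

Require Import Defs.
From mathcomp Require Import all_boot all_order all_algebra.
From mathcomp Require Import boolp classical_sets functions cardinality.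
From mathcomp Require Import zify.

Set Implicit Arguments.
Unset Strict Implicit.
Unset Printing Implicit Defensive.

Import Order.TTheory GRing.Theory Num.Theory.

Local Open Scope ring_scope.

(** * The cycle lemma for integer sequences of sum 1 *)

Definition dominating (s : seq int) : bool :=
  all (fun i => 0 < \sum_(x <- take i.+1 s) x) (iota 0 (size s)).

Lemma dominatingP (s : seq int) :
  reflect (forall i, (0 < i <= size s)%N -> 0 < \sum_(x <- take i s) x)
          (dominating s).
Proof.
apply: (iffP allP) => [h [|i] // /andP[_ lis]|h i].
  by apply: h; rewrite mem_iota.
by rewrite mem_iota => /andP[_ lis]; apply: h.
Qed.

(** Start at the last minimum [r] of the prefix sums [S]. Before the wrap the prefix sums are
    [S (r + i) - S r], positive because the minimum is the last one; after it they are
    [1 - S r + S j], at least 1 by minimality. *)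
Lemma dominating_rot_exists (s : seq int) : \sum_(x <- s) x = 1 ->
  exists2 r, (r < size s)%N & dominating (rot r s).
Proof.
move=> s1; pose S i : int := \sum_(x <- take i s) x.
have s_gt0 : (0 < size s)%N by case: s s1 @S => //; rewrite big_nil.
(* [r] is the last index at which the prefix sum is minimal. *)
have [r rs /= [rmin rlast]] : exists2 r, (r < size s)%N &
    (forall j, (j < size s)%N -> S r <= S j) /\
    (forall j, (r < j < size s)%N -> S r < S j).
  elim: (size s) s_gt0 => // m IH _.
  case: m IH => [_|m /(_ isT)[r rm [rmin rlast]]].
    by exists 0%N => //; split=> [[]|[]].
  have [Sle|Slt] := leP (S m.+1) (S r).
    exists m.+1 => //; split=> [j|j].
      rewrite ltnS leq_eqVlt => /orP[/eqP->//|jm].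
      exact: le_trans Sle (rmin _ jm).
    by move=> /andP[/leq_trans h/h]; rewrite ltnn.
  exists r; first exact: ltnW; split=> j.
    by rewrite ltnS leq_eqVlt => /orP[/eqP->|/rmin //]; apply: ltW.
  rewrite ltnS (leq_eqVlt j) => /andP[rj /orP[/eqP->//|jm]].
  by apply: rlast; rewrite rj.
have sumE i j : (i <= j)%N -> S j = S i + \sum_(x <- take (j - i) (drop i s)) x.
  by move=> ij; rewrite /S -big_cat /= -takeD subnKC.
have SE : S (size s) = 1 by rewrite /S take_size.
exists r => //; apply/dominatingP => i; rewrite size_rot => /andP[i0 lis].
rewrite /rot take_cat size_drop; case: ltnP => [ir|ri].
  have := rlast (r + i)%N; rewrite (sumE r (r + i)%N) ?leq_addr // addKn ltrDl.
  by apply; rewrite -[X in (X < _)%N]addn0 ltn_add2l i0 -ltn_subRL.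
rewrite big_cat /= take_takel; last by rewrite leq_subLR subnK // ltnW.
(* The part from [r] to the end contributes [1 - S r]; the wrapped prefix then adds [S j]. *)
have := sumE r (size s) (ltnW rs); rewrite SE take_oversize ?size_drop // => e.
set j := (i - _)%N.
have js : (j < size s)%N.
  rewrite /j ltn_subLR // (leq_ltn_trans lis) // -[X in (X < _)%N]add0n.
  by rewrite ltn_add2r subn_gt0.
have := rmin j js; rewrite -(lerD2r (\sum_(x <- drop r s) x)) -e /S addrC.
exact: lt_le_trans.
Qed.

(** The arc from [i] to [j] is a prefix of [rot i s] and the complementary arc a prefix of
    [rot j s]. If both rotations dominated, two positive integers would add up to 1. *)
Lemma dominating_rot_lt (s : seq int) (i j : nat) : \sum_(x <- s) x = 1 ->
  (i < j < size s)%N -> dominating (rot i s) -> ~~ dominating (rot j s).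
Proof.
move=> s1 /andP[ij js] /dominatingP di; apply/negP => /dominatingP dj.
have e : drop i s = take (j - i) (drop i s) ++ drop j s.
  by rewrite -{1}(cat_take_drop (j - i) (drop i s)) drop_drop subnK // ltnW.
have ti : take (j - i) (rot i s) = take (j - i) (drop i s).
  by rewrite /rot take_cat size_drop ltn_sub2r // (ltn_trans ij).
have tj : take (size s - j + i) (rot j s) = drop j s ++ take i s.
  rewrite /rot take_cat size_drop ltnNge leq_addr /= addKn.
  by rewrite take_takel // ltnW.
have := di (j - i)%N; rewrite ti size_rot subn_gt0 ij.
rewrite (leq_trans (leq_subr _ _) (ltnW js)) => /(_ isT) A0.
have := dj (size s - j + i)%N; rewrite tj size_rot.
rewrite addn_gt0 subn_gt0 js -{2}(subnK (ltnW js)) leq_add2l (ltnW ij).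
move=> /(_ isT) B0.
have : \sum_(x <- take (j - i) (drop i s)) x + \sum_(x <- drop j s ++ take i s) x
       = 1 :> int.
  by rewrite -big_cat catA -e /= big_cat /= addrC -big_cat cat_take_drop.
by move: A0 B0; rewrite !gtz0_ge1 => A0 B0 h; have := lerD A0 B0; rewrite h.
Qed.

Lemma cycle_lemma (s : seq int) : \sum_(x <- s) x = 1 ->
  (\sum_(r < size s) dominating (rot r s) = 1)%N.
Proof.
move=> s1; have [r rs dr] := dominating_rot_exists s1.
rewrite (bigD1 (Ordinal rs)) //= dr big1 // => i /eqP ir.
apply/eqP; rewrite eqb0; have [lt|lt|eq] := ltngtP r i.
- by apply: (dominating_rot_lt (i := r)); rewrite ?lt /=.
- apply/negP => di; have := dominating_rot_lt s1 _ di.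
  by move=> /(_ r); rewrite lt rs dr => /(_ isT).
- by case: ir; apply: val_inj.
Qed.

(** * Words encoding labelled paths *)

(* A Schroder path is read as a word: the letter [(b, o)] is the step [U] (if
   [b]) or [H], followed by the run of down steps before the next [U] or [H];
   [o = None] is the empty run and [o = Some B] a run of length [#|B|.+1]
   labelled by [B]. *)
Definition letter (e : nat) : finType := (bool * option {set 'I_e})%type.

Definition run_length (e : nat) (o : option {set 'I_e}) : nat :=
  if o is Some B then #|B|.+1 else 0.

(** The occurrences of [H] and [DD] inside a letter. No [DD] straddles two letters, since each
    letter begins with [U] or [H]. *)
Definition weight (e : nat) (a : letter e) : nat := ~~ a.1 + (run_length a.2).-1.

Definition rise (e : nat) (a : letter e) : int := a.1%:Z - (run_length a.2)%:Z.

Definition total_weight (e : nat) (w : seq (letter e)) : nat :=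
  \sum_(a <- w) weight a.

Definition total_rise (e : nat) (w : seq (letter e)) : int :=
  \sum_(a <- w) rise a.

Definition runs (e : nat) (w : seq (letter e)) : nat :=
  \sum_(a <- w) isSome a.2.

(** * Counting words by runs and weight *)

Lemma expr_sum_tuple (R : comPzSemiRingType) (A : finType) (m : nat)
    (g : A -> R) :
  (\sum_a g a) ^+ m = \sum_(w : m.-tuple A) \prod_(a <- w) g a.
Proof.
rewrite -[m in LHS]card_ord -prodr_const bigA_distr_bigA.
rewrite (reindex (@finfun_of_tuple A m)) /=; last first.
  by apply: onW_bij; exists (@tuple_of_finfun A m);
    [exact: finfun_of_tupleK | exact: tuple_of_finfunK].
by apply: eq_bigr => w _; rewrite big_tuple; apply: eq_bigr => i _; rewrite ffunE.
Qed.

Lemma sum_expr_card (R : comPzSemiRingType) (T : finType) (y : R) :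
  \sum_(B : {set T}) y ^+ #|B| = (1 + y) ^+ #|T|.
Proof.
rewrite addrC -prodr_const bigA_distr; apply: eq_bigr => B _.
by rewrite -big_mkcond prodr_const.
Qed.

(** The factor [1 + y] is the choice between [U] and [H]. In the other factor, 1 is the empty run
    and [x * (1 + y) ^+ e] sums over the label sets, since a run labelled by [B] holds [#|B|]
    occurrences of [DD]. *)
Lemma sum_letter (e : nat) (R : comPzSemiRingType) (x y : R) :
  \sum_(a : letter e) x ^+ isSome a.2 * y ^+ weight a =
  (1 + y) * (1 + x * (1 + y) ^+ e).
Proof.
pose F b (o : option {set 'I_e}) :=
  y ^+ (~~ b) * (x ^+ isSome o * y ^+ (run_length o).-1).
rewrite (eq_bigr (fun a => F a.1 a.2)) => [|[b o] _]; last first.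
  by rewrite /F /weight /= exprD mulrCA.
rewrite -(pair_bigA _ F) /= /F.
under eq_bigr do rewrite -big_distrr.
rewrite -big_distrl /= big_bool expr0 expr1; congr (_ * _).
rewrite (bigD1 None) //= expr0 mulr1; congr (_ + _).
rewrite (reindex_omap Some id) => [|[B|] //].
rewrite (eq_bigl predT) => [|B]; last by rewrite eqxx.
by rewrite -[e in RHS]card_ord -sum_expr_card big_distrr.
Qed.

Lemma coef_expr1DcX (R : comNzRingType) (c : R) (m j : nat) :
  ((1 + c *: 'X) ^+ m)`_j = c ^+ j *+ 'C(m, j).
Proof.
rewrite exprDn coef_sum.
under eq_bigr => i _ do rewrite expr1n mul1r coefMn exprZn coefZ coefXn.
have [jm|mj] := leqP j m; last first.
  rewrite bin_small // mulr0n big1 // => i _.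
  by rewrite gtn_eqF ?mulr0 ?mul0rn // (leq_trans _ mj).
rewrite (bigD1 (Ordinal (jm : (j < m.+1)%N))) //= eqxx mulr1 big1 ?addr0 //.
move=> i /eqP ij; case: eqP => [eji|_]; last by rewrite mulr0 mul0rn.
by case: ij; apply: val_inj.
Qed.

Lemma card_words (e m j k : nat) :
  #|[set w : m.-tuple (letter e) | (runs w == j) && (total_weight w == k)]| =
  ('C(m, j) * 'C(m + j * e, k))%N.
Proof.
(* The outer variable [x] marks runs and the inner variable [y] marks weight, so the count is the
   coefficient of index [j], then [k]. *)
pose x : {poly {poly int}} := 'X; pose y : {poly {poly int}} := 'X%:P.
have gf : \sum_(w : m.-tuple (letter e)) x ^+ runs w * y ^+ total_weight w =
    ((1 + y) * (1 + x * (1 + y) ^+ e)) ^+ m.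
  rewrite -sum_letter expr_sum_tuple; apply: eq_bigr => w _.
  rewrite big_split /= /runs (big_morph _ (exprD x) (expr0 x)).
  by rewrite /total_weight (big_morph _ (exprD y) (expr0 y)).
apply/eqP; rewrite -eqz_nat; apply/eqP.
transitivity ((\sum_(w : m.-tuple (letter e))
    x ^+ runs w * y ^+ total_weight w)`_j`_k).
  rewrite !coef_sum -sum1_card (big_morph _ PoszD (erefl _)) big_mkcond /=.
  apply: eq_bigr => w _; rewrite inE -polyC_exp coefMC coefXn eq_sym.
  case: eqP => _; last by rewrite mul0r coef0.
  by rewrite mul1r coefXn eq_sym; case: eqP.
(* The factor [(1 + y) ^+ m] is constant in [x], so the [j]-th coefficient is
   [(1 + y) ^+ (m + j * e)] times a binomial. *)
rewrite gf; have -> : ((1 + y) * (1 + x * (1 + y) ^+ e)) ^+ m =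
    ((1 + 'X) ^+ m)%:P * (1 + (1 + 'X) ^+ e *: 'X) ^+ m.
  by rewrite -mul_polyC !polyC_exp polyCD polyC1 [x * _]mulrC exprMn.
rewrite coefCM coef_expr1DcX mulrnAr -exprM -exprD coefMn -['X]scale1r.
by rewrite coef_expr1DcX expr1n -mulrnA natz (mulnC j) mulnC.
Qed.

(** For each letter, the rise, the weight and the indicator of a nonempty run add up to 1. Hence
    rise 1 and weight [k] on [n.+1] letters force [n - k] runs. *)
Lemma rise_weight_runs (e : nat) (w : seq (letter e)) :
  total_rise w + (total_weight w)%:Z + (runs w)%:Z = (size w)%:Z.
Proof.
rewrite /total_rise /total_weight /runs.
elim: w => [|[b o] w IH]; first by rewrite !big_nil.
rewrite !big_cons /= !PoszD -add1n PoszD -IH /rise /weight /=.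
set r := \sum_(a <- w) _; set t := Posz (\sum_(a <- w) _).
set u := Posz (\sum_(a <- w) _).
by case: b o => [] [B|] /=; lia.
Qed.

(** * Ballot words and rotations of balanced words *)

Fixpoint nonneg_from (h : int) (s : seq int) : bool :=
  (0 <= h) && (if s is x :: s' then nonneg_from (h + x) s' else true).

Lemma nonneg_fromP (h : int) (s : seq int) :
  reflect (forall i, (i <= size s)%N -> 0 <= h + \sum_(x <- take i s) x)
          (nonneg_from h s).
Proof.
elim: s h => [|x s IH] h /=.
  rewrite andbT; apply: (iffP idP) => [h0 i _|/(_ 0%N isT)].
    by rewrite big_nil addr0.
  by rewrite big_nil addr0.
apply: (iffP andP) => [[h0 /IH hs] [|i] lis|hs].
- by rewrite take0 big_nil addr0.
- by rewrite /= big_cons addrA; apply: hs.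
split; first by have := hs 0%N isT; rewrite big_nil addr0.
by apply/IH => i lis; have := hs i.+1 lis; rewrite /= big_cons addrA.
Qed.

Lemma dominating_cons1 (s : seq int) : dominating (1 :: s) = nonneg_from 0 s.
Proof.
apply/dominatingP/nonneg_fromP => hs i lis.
  by have := hs i.+1 lis; rewrite /= big_cons; lia.
case: i lis => // i /andP[_ lis].
by rewrite /= big_cons ltr_wpDr // -[X in _ <= X]add0r hs.
Qed.

Lemma dominating_cons_le1 (x : int) (s : seq int) : x <= 1 ->
  dominating (x :: s) -> x = 1.
Proof.
move=> x1 /dominatingP /(_ 1%N isT); rewrite /= take0 big_seq1 gtz0_ge1 => x0.
by apply/eqP; rewrite eq_le x1.
Qed.

Lemma rise_le1 (e : nat) (a : letter e) : rise a <= 1.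
Proof. by rewrite /rise lerBlDr; case: a.1 => /=; rewrite ?lerDl. Qed.

Lemma rise_eq1 (e : nat) (a : letter e) : rise a = 1 -> a = (true, None).
Proof. by case: a => [[] [B|]] //=; rewrite /rise /=; lia. Qed.

Lemma rise_up (e : nat) : @rise e (true, None) = 1.
Proof. by []. Qed.

Lemma weight_up (e : nat) : @weight e (true, None) = 0%N.
Proof. by []. Qed.

Definition ballot_words (e n k : nat) : {set n.-tuple (letter e)} :=
  [set w : n.-tuple (letter e) | [&& nonneg_from 0 (map (@rise e) w),
     total_rise w == 0 & total_weight w == k]].

Definition balanced_words (e n k : nat) : {set n.+1.-tuple (letter e)} :=
  [set w : n.+1.-tuple (letter e) | (total_rise w == 1) && (total_weight w == k)].

Lemma card_balanced_words (e n k : nat) :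
  #|balanced_words e n k| = ('C(n.+1, k.+1) * 'C(n + (n - k) * e + 1, k))%N.
Proof.
have [kn|nk] := leqP k n; last first.
  rewrite bin_small // mul0n; apply: eq_card0 => w; rewrite inE.
  apply/negP => /andP[/eqP rw /eqP ww].
  by have := rise_weight_runs w; rewrite size_tuple rw ww; lia.
(* By symmetry ['C(n.+1, k.+1)] is ['C(n.+1, n - k)], the choice of the letters with a nonempty
   run. *)
rewrite -(bin_sub (_ : k.+1 <= n.+1)%N) // subSS addn1 -addSn -card_words.
apply: eq_card => w; rewrite !inE andbC [RHS]andbC; case: eqP => //= ww.
have := rise_weight_runs w; rewrite size_tuple ww.
by move: (total_rise _) (runs _) => r j; lia.
Qed.

(** The first letter of a dominating word has positive rise, hence is the bare [U]; deleting it
    leaves a ballot word. *)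
Lemma card_dominating_words (e n k : nat) :
  #|[set w in balanced_words e n k | dominating (map (@rise e) w)]| =
  #|ballot_words e n k|.
Proof.
pose f (w : n.-tuple (letter e)) :=
  [tuple of (true, None : option {set 'I_e}) :: w].
have f_inj : injective f by move=> w w' [] /val_inj.
rewrite -(card_imset _ f_inj); apply: eq_card => w; apply/idP/imsetP.
  case/tupleP: w => a w; rewrite !inE => /andP[/andP[/eqP ra /eqP wa] dom].
  have /rise_eq1 ea := dominating_cons_le1 (rise_le1 a) dom.
  move: ra wa dom; rewrite {}ea /total_rise /total_weight !big_cons.
  rewrite rise_up weight_up add0n => ra wa dom.
  exists w; last by apply: val_inj.
  rewrite inE -dominating_cons1 dom /total_weight wa eqxx andbT /total_rise.
  by apply/eqP; apply: (addrI 1); rewrite ra addr0.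
case=> v; rewrite [v \in _]inE => /and3P[dom /eqP rw /eqP ww] ->.
rewrite !inE /= rise_up dominating_cons1 dom andbT.
move: rw ww; rewrite /total_rise /total_weight !big_cons rise_up weight_up.
by move=> -> ->; rewrite !eqxx.
Qed.

(** Double counting of the pairs of a balanced word and a rotation making it dominating: each word
    has one such rotation, and each rotation permutes the balanced words. *)
Lemma card_ballot_words (e n k : nat) :
  (n.+1 * #|ballot_words e n k|)%N = #|balanced_words e n k|.
Proof.
have rot_bal r (w : n.+1.-tuple (letter e)) :
    ([tuple of rot r w] \in balanced_words e n k) = (w \in balanced_words e n k).
  rewrite !inE /total_rise /total_weight /=.
  by rewrite !(perm_big _ (permEl (perm_rot r w))).
transitivity (\sum_(w in balanced_words e n k) \sum_(r < n.+1)
    dominating (map (@rise e) (rot r w)))%N.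
  rewrite exchange_big /= -card_dominating_words.
  rewrite -[X in (X * _)%N](card_ord n.+1) -sum_nat_const; apply: eq_bigr => r _.
  pose h (w : n.+1.-tuple (letter e)) := [tuple of rot r w].
  rewrite -sum1_card (reindex_inj (h := h)); last first.
    by move=> w w' /(congr1 val) /= /rot_inj /val_inj.
  rewrite big_mkcond [RHS]big_mkcond /=; apply: eq_bigr => w _.
  by rewrite inE rot_bal; case: (_ \in _); case: dominating.
rewrite -sum1_card; apply: eq_bigr => w; rewrite inE => /andP[/eqP rw _].
rewrite -[RHS](@cycle_lemma (map (@rise e) w)) ?big_map // size_map size_tuple.
by apply: eq_bigr => r _; rewrite map_rot.
Qed.

(** * Paths as sequences of blocks *)

Definition block (b : bool) (l : nat) : seq step :=
  (if b then U else H) :: nseq l D.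

Definition block_rise (x : bool * nat) : int := x.1%:Z - x.2%:Z.

Definition path_of_blocks (v : seq (bool * nat)) : seq step :=
  flatten [seq block x.1 x.2 | x <- v].

Lemma path_of_blocks_cons (b : bool) (l : nat) (v : seq (bool * nat)) :
  path_of_blocks ((b, l) :: v) =
  (if b then U else H) :: (nseq l D ++ path_of_blocks v).
Proof. by []. Qed.

Definition no_initial_D (p : seq step) : bool := ohead p != Some D.

Lemma no_initial_D_path (v : seq (bool * nat)) : no_initial_D (path_of_blocks v).
Proof. by case: v => [|[[] l] v]. Qed.

Lemma blocks_of_path (p : seq step) :
  exists r v, p = nseq r D ++ path_of_blocks v.
Proof.
elim: p => [|s p [r [v ->]]]; first by exists 0%N, [::].
case: s; first by exists 0%N, ((true, r) :: v).
  by exists r.+1, v.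
by exists 0%N, ((false, r) :: v).
Qed.

Lemma descents_from_nseq (r l : nat) (p : seq step) :
  descents_from r (nseq l D ++ p) = descents_from (r + l) p.
Proof. by elim: l r => [|l IH] r /=; rewrite ?addn0 // IH addnS. Qed.

Lemma descents_from_no_initial_D (r : nat) (p : seq step) : no_initial_D p ->
  descents_from r p = nseq (0 < r) r ++ descents p.
Proof. by case: p => [|[] p]; case: r. Qed.

Lemma descents_path (v : seq (bool * nat)) :
  descents (path_of_blocks v) = [seq l <- map snd v | (0 < l)%N].
Proof.
elim: v => [|[b l] v IH] //=.
transitivity (descents_from 0 (nseq l D ++ path_of_blocks v)); first by case: b.
rewrite descents_from_nseq descents_from_no_initial_D ?no_initial_D_path // IH.
by case: l.
Qed.

Lemma nonneg_from_D (h : int) (l : nat) (s : seq int) :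
  nonneg_from h (nseq l (-1) ++ s) = nonneg_from (h - l%:Z) s.
Proof.
elim: l h => [|l IH] h /=; first by rewrite subr0.
(* Heights decrease along a descent, so nonnegativity at its end gives it at its start. *)
rewrite IH -addrA -opprD -PoszD add1n andb_idl // => /nonneg_fromP /(_ 0%N isT).
by rewrite take0 big_nil; lia.
Qed.

Lemma nonneg_from_path (h : int) (v : seq (bool * nat)) :
  nonneg_from h (map dy (path_of_blocks v)) =
  nonneg_from h (map block_rise v).
Proof.
elim: v h => [|[b l] v IH] h //=.
rewrite map_cat map_nseq nonneg_from_D IH; case: b => //=;
by rewrite ?addrA ?addr0.
Qed.

Lemma ordinate_path (v : seq (bool * nat)) :
  ordinate (path_of_blocks v) = \sum_(x <- v) block_rise x.
Proof.
rewrite /ordinate; elim: v => [|[b l] v IH]; first by rewrite !big_nil.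
rewrite /= !big_cons big_cat /= IH addrA /block_rise /=; congr (_ + _).
by rewrite big_nseq; case: b => /=; rewrite iter_addr_0 mulNrn natz.
Qed.

Lemma schroder_pathE (p : seq step) :
  schroder_path p <-> nonneg_from 0 (map dy p) /\ ordinate p = 0.
Proof.
split=> -[hp op]; split=> //.
  apply/nonneg_fromP => i; rewrite size_map => /hp.
  by rewrite -map_take big_map add0r.
move=> i lip; move/nonneg_fromP: hp => /(_ i); rewrite size_map => /(_ lip).
by rewrite -map_take big_map add0r.
Qed.

Lemma schroder_path_no_initial_D (r : nat) (p : seq step) :
  schroder_path (nseq r D ++ p) -> r = 0%N.
Proof.
case=> hp _; case: r hp => // r /(_ 1%N isT).
by rewrite /ordinate /= take0 big_seq1.
Qed.

(** Each block has width 2 minus its rise, so on a path ending at height 0 the semilength is the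
    number of blocks. *)
Lemma abscissa_path (v : seq (bool * nat)) :
  (abscissa (path_of_blocks v))%:Z =
  (size v).*2%:Z - \sum_(x <- v) block_rise x.
Proof.
rewrite /abscissa; elim: v => [|[b l] v IH]; first by rewrite !big_nil.
rewrite /= !big_cons big_cat /= big_nseq iter_addn_0 mul1n !PoszD IH.
rewrite /block_rise /=.
by move: (\sum_(_ <- _) _) => t; case: b => /=; lia.
Qed.

Lemma semilength_path (v : seq (bool * nat)) :
  ordinate (path_of_blocks v) = 0 -> semilength (path_of_blocks v) = size v.
Proof.
rewrite ordinate_path /semilength => v0; have := abscissa_path v.
by rewrite v0 subr0 => -[->]; rewrite doubleK.
Qed.

Lemma count_DD_nseq (l : nat) (p : seq step) : no_initial_D p ->
  count_DD (nseq l D ++ p) = (l.-1 + count_DD p)%N.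
Proof.
rewrite /count_DD; elim: l => [|l IH] // np.
by have := IH np; case: l {IH} => [|l] /=; [case: p np => [|[] p] | move=> ->].
Qed.

Lemma count_DD_cons (s : step) (p : seq step) : s != D ->
  count_DD (s :: p) = count_DD p.
Proof. by case: s; case: p. Qed.

Lemma count_path (v : seq (bool * nat)) :
  (count_H (path_of_blocks v) + count_DD (path_of_blocks v) =
   \sum_(x <- v) (~~ x.1 + x.2.-1))%N.
Proof.
elim: v => [|[b l] v IH]; first by rewrite big_nil.
rewrite big_cons -IH path_of_blocks_cons count_DD_cons; last by case: b.
rewrite count_DD_nseq ?no_initial_D_path // /count_H /= count_cat count_nseq.
by case: b => /=; lia.
Qed.

(** * Labels and the injection of words into labelled paths *)

Definition blocks (e : nat) (w : seq (letter e)) : seq (bool * nat) :=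
  [seq (a.1, run_length a.2) | a <- w].

Definition labels (e : nat) (w : seq (letter e)) : seq {set 'I_e} :=
  pmap snd w.

Lemma labels_card (e : nat) (w : seq (letter e)) :
  [seq #|A : {set 'I_e}| | A <- labels w] =
  [seq (l - 1)%N | l <- descents (path_of_blocks (blocks w))].
Proof.
rewrite descents_path; elim: w => [|[b [B|]] w IH] //=.
by rewrite subn1 /= -IH.
Qed.

Lemma labels_inj (e : nat) (w w' : seq (letter e)) :
  blocks w = blocks w' -> labels w = labels w' -> w = w'.
Proof.
elim: w w' => [|[b o] w IH] [|[b' o'] w'] //= [<-].
by case: o o' => [B|] [B'|] //= _ eb => [[<-]|] el; rewrite (IH w').
Qed.

(** The labels are consumed from left to right, one for each nonempty run; the cardinality condition
    makes each label fit its run. *)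
Lemma labels_surj (e : nat) (v : seq (bool * nat)) (ls : seq {set 'I_e}) :
  [seq #|A : {set 'I_e}| | A <- ls] =
  [seq (l - 1)%N | l <- descents (path_of_blocks v)] ->
  exists2 w, v = blocks w & ls = labels w.
Proof.
rewrite descents_path; elim: v ls => [|[b [|l]] v IH] /= ls.
- by case: ls => // _; exists [::].
- by move=> /IH[w -> ->]; exists ((b, None) :: w).
case: ls => // A ls [Al /IH[w -> ->]].
by exists ((b, Some A) :: w); rewrite //= Al subn1.
Qed.

(** A path made of blocks never begins with [D], so the run closing the first block can be read
    off. *)
Lemma path_of_blocks_inj : injective path_of_blocks.
Proof.
have aux v v' l l' :
    nseq l D ++ path_of_blocks v = nseq l' D ++ path_of_blocks v' ->
    l = l' /\ path_of_blocks v = path_of_blocks v'.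
  elim: l l' => [|l IH] [|l'] //=.
  - by move=> e; have := no_initial_D_path v; rewrite e.
  - by move=> e; have := no_initial_D_path v'; rewrite -e.
  - by case=> /IH[-> ->].
elim=> [|[b l] v IH] [|[b' l'] v'] //= [eb /aux[-> /IH ->]].
by case: b b' eb => [] [].
Qed.

Definition labelled_of_word (d n : nat) (w : n.-tuple (letter (d - 2))) :
  labelled_path d := (path_of_blocks (blocks w), labels w).

Lemma labelled_of_word_inj (d n : nat) : injective (@labelled_of_word d n).
Proof.
by move=> w w' [/path_of_blocks_inj eb el]; apply/val_inj/labels_inj.
Qed.

(** * Cardinality of the set of labelled paths *)

Local Open Scope classical_set_scope.
Local Open Scope card_scope.

Lemma finset_card_eq (T : finType) (A : {set T}) : [set` A] #= `I_#|A|.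
Proof.
have -> : [set` A] = (@enum_val _ (mem A)) @` [set: 'I_#|A|].
  apply/seteqP; split=> [x /= xA|x /= [i _ <-]]; last exact: enum_valP.
  by exists (enum_rank_in xA x) => //; rewrite enum_rankK_in.
apply: card_eq_trans; last exact/card_esym/card_II.
by apply: inj_card_eq => i j _ _; apply: enum_val_inj.
Qed.

Lemma labelled_schroder_image (d n k : nat) : (2 <= d)%N ->
  [set x : labelled_path d | [/\ labelled_schroder d x,
     semilength x.1 = n & (count_H x.1 + count_DD x.1)%N = k]] =
  @labelled_of_word d n @` [set` ballot_words (d - 2) n k].
Proof.
move=> hd; apply/seteqP; split=> [[p ls] /= [[sp dl lc] pn pk]|x /= [w]].
  rewrite /= in sp lc.
  have [r [v pE]] := blocks_of_path p.
  have r0 : r = 0%N by move: sp; rewrite pE => /schroder_path_no_initial_D.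
  move: pE; rewrite {}r0 /= => pE; subst p.
  have [w vE lE] := labels_surj lc; subst v ls.
  have /schroder_pathE[nn o0] := sp.
  have wn : size w == n by rewrite -pn semilength_path // size_map.
  exists (Tuple wn) => //.
  rewrite /= inE; apply/and3P; split.
  - by move: nn; rewrite nonneg_from_path -map_comp.
  - by move: o0; rewrite ordinate_path big_map => /eqP.
  - by move: pk; rewrite count_path big_map => /eqP.
rewrite inE => /and3P[nn o0 /eqP wk] <- /=.
have o0' : ordinate (path_of_blocks (blocks w)) = 0.
  by rewrite ordinate_path big_map; apply/eqP.
split.
- split=> /=; last exact: labels_card.
    by apply/schroder_pathE; split=> //; rewrite nonneg_from_path -map_comp.
  move=> l; rewrite descents_path mem_filter => /andP[_].
  case/mapP => -[b l'] /mapP[[b' o] _ /= [_ ->]] ->; case: o => //= B.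
  (* The run has length [#|B|.+1] with [B] inside a set of [d - 2] elements; [2 <= d] makes this at
     most [d - 1]. *)
  by apply: leq_ltn_trans (max_card _) _; rewrite card_ord; lia.
- by rewrite semilength_path // size_map size_tuple.
- by rewrite count_path big_map.
Qed.

Theorem theorem4p1 (d n k : nat) (hd : (2 <= d)%N) :
  exists2 m : nat,
    [set x : labelled_path d | [/\ labelled_schroder d x,
       semilength x.1 = n & (count_H x.1 + count_DD x.1)%N = k]] #= `I_m
    & N_ d n k = m%:R.
Proof.
exists #|ballot_words (d - 2) n k|.
  rewrite labelled_schroder_image //; apply: card_eq_trans.
    by apply: inj_card_eq => w w' _ _; apply: labelled_of_word_inj.
  exact: finset_card_eq.
rewrite /N_ -mulrA -natrM -card_balanced_words -card_ballot_words natrM mulKf //.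
by rewrite pnatr_eq0.
Qed.
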